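(* Let $d\ge2$ be an integer, $0<\xi\le1$ and $\vartheta\in[1,d]$. Let $\mathrm{val}(\mathcal U_\rho)$ be the supremum of $$\int_{\mathbb S_+}\big(u_1^\xi+\cdots+u_d^\xi\big)^{1/\xi}H(d\boldsymbol u)$$ over all finite Borel measures $H$ on $\mathbb S_+$ satisfying $$\int_{\mathbb S_+}u_j\,H(d\boldsymbol u)=1,\ j=1,\dots,d,\qquad\text{and}\qquad\int_{\mathbb S_+}\max_{j=1,\dots,d}u_j\,H(d\boldsymbol u)=\vartheta.$$ Then $$\mathrm{val}(\mathcal U_\rho)=U(\vartheta):=\left\{\vartheta^\xi+(d-1)^{1-\xi}(d-\vartheta)^\xi\right\}^{1/\xi}=\sup_{\boldsymbol u\in\mathbb S_+}\left\{d\Big(\sum_{j=1}^du_j^\xi\Big)^{1/\xi}:\ \max_{j=1,\dots,d}u_j=\frac{\vartheta}{d}\right\}.$$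
   Context: $\mathbb S_+=\{\boldsymbol u\in[0,\infty)^d:\sum_{i=1}^du_i=1\}$ is the unit simplex; all measures are non-negative. *)

(* Defs.v *)
From mathcomp Require Import all_boot all_order all_algebra.
From mathcomp Require Import all_classical all_reals all_analysis.

Set Implicit Arguments.
Unset Strict Implicit.
Unset Printing Implicit Defensive.

Import Order.TTheory GRing.Theory Num.Theory.
Import numFieldNormedType.Exports.

Local Open Scope classical_set_scope.
Local Open Scope ring_scope.

Notation borel_rV R d := (g_sigma_algebraType (@open 'rV[R]_d)).

Definition simplex (R : realType) (d : nat) : set 'rV[R]_d :=
  [set u | (forall j, 0 <= u ord0 j) /\ \sum_(j < d) u ord0 j = 1].
Arguments simplex : clear implicits.

(* The default value 0 is harmless on the simplex, whose coordinates are
   nonnegative. *)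
Definition maxcoord (R : realType) (d : nat) (u : 'rV[R]_d) : R :=
  \big[Num.max/0]_(j < d) u ord0 j.

Definition powersum (R : realType) (d : nat) (xi : R) (u : 'rV[R]_d) : R :=
  (\sum_(j < d) u ord0 j `^ xi) `^ xi^-1.

(* A finite Borel measure on the simplex is represented by a finite Borel
   measure on R^d that is concentrated on the simplex. *)
Definition feasible (R : realType) (d : nat) (theta : R)
    (H : {finite_measure set (borel_rV R d) -> \bar R}) : Prop :=
  [/\ H (~` simplex R d) = 0%E,
      forall j : 'I_d, (\int[H]_(u in simplex R d) (u ord0 j)%:E = 1)%E &
      (\int[H]_(u in simplex R d) (maxcoord u)%:E = theta%:E)%E].

Definition valU (R : realType) (d : nat) (xi theta : R) : \bar R :=
  ereal_sup [set (\int[H]_(u in simplex R d) (powersum xi u)%:E)%E |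
    H in [set H : {finite_measure set (borel_rV R d) -> \bar R}
         | feasible theta H]].

Definition Ubound (R : realType) (d : nat) (xi theta : R) : R :=
  (theta `^ xi + (d%:R - 1) `^ (1 - xi) * (d%:R - theta) `^ xi) `^ xi^-1.

(* Main.v *)
(* Write v = spike a k for the point of the simplex with coordinate a at k and
   the remaining mass spread evenly. Weighting coordinate j by v_j^xi / S with
   S = sum_i v_i^xi, Jensen's inequality for x |-> x^xi bounds powersum xi u by
   a linear form in u that is exact at v. When k is the index of the largest
   coordinate of u, this form depends on u only through maxcoord u, and it has
   the same coefficients for all k; with a = theta / d, integrating it against
   H gives the upper bound, since the marginal constraints force H to have
   total mass d. The sum of the Dirac masses at the d points spike (theta / d) k
   attains it. *)
From HB Require Import structures.
Require Import Defs.
From mathcomp Require Import all_boot all_order all_algebra.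
From mathcomp Require Import all_classical all_reals all_analysis.
From mathcomp Require Import measurable_realfun ring lra.

Set Implicit Arguments.
Unset Strict Implicit.
Unset Printing Implicit Defensive.

Import Order.TTheory GRing.Theory Num.Theory.
Import numFieldNormedType.Exports.

Local Open Scope classical_set_scope.
Local Open Scope ring_scope.

(** * Tangents and Jensen's inequality for concave powers *)

Lemma powR_le_tangent (R : realType) (p x y : R) :
  0 < p <= 1 -> 0 <= x -> 0 < y ->
  x `^ p <= y `^ p * (p * (x / y) + (1 - p)).
Proof.
move=> /andP[p0 p1] x0 y0.
set r := x / y.
have r0 : 0 <= r by rewrite divr_ge0// ltW.
have -> : x = y * r by rewrite mulrC divfK ?gt_eqF.
rewrite powRM ?(ltW y0)// ler_pM2l ?powR_gt0//.
(* The bound on r^p is Young's inequality for r^p and 1 with exponents 1/p and 1/(1 - p), which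
   forces p = 1 to be treated apart. *)
have [->|pN1] := eqVneq p 1.
  by rewrite powRr1// mul1r subrr addr0.
have p'0 : 0 < 1 - p by rewrite subr_gt0 lt_neqAle pN1.
have := @conjugate_powR R (r `^ p) 1 p^-1 (1 - p)^-1 (powR_ge0 _ _) ler01.
rewrite !invr_gt0 !invrK => /(_ p0 p'0); rewrite addrCA subrr addr0 => /(_ erefl).
by rewrite mulr1 -powRrM divff ?gt_eqF// powRr1// powR1 mul1r (mulrC r).
Qed.

(** Average the tangent bounds taken at the weighted mean [m]: the first-order terms cancel. There
    is no tangent at [m = 0], but then every [w i * f i] vanishes. *)
Lemma powR_jensen (R : realType) (I : finType) (p : R) (w f : I -> R) :
  0 < p <= 1 -> (forall i, 0 <= w i) -> \sum_i w i = 1 ->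
  (forall i, 0 <= f i) ->
  \sum_i w i * f i `^ p <= (\sum_i w i * f i) `^ p.
Proof.
move=> hp w0 w1 f0; have /andP[p0 _] := hp.
set m := \sum_i w i * f i.
have m0 : 0 <= m by apply: sumr_ge0 => i _; rewrite mulr_ge0.
have [mE|mN0] := eqVneq m 0.
  rewrite big1 ?powR_ge0// => i _.
  have /eqP : w i * f i = 0.
    by move: mE => /psumr_eq0P -> // j _; rewrite mulr_ge0.
  by rewrite mulf_eq0 => /orP[|] /eqP ->; rewrite ?mul0r// powR0 ?mulr0 ?gt_eqF.
have {mN0}m_gt0 : 0 < m by rewrite lt_neqAle eq_sym mN0.
apply: (@le_trans _ _ (\sum_i w i * (m `^ p * (p * (f i / m) + (1 - p))))).
  by apply: ler_sum => i _; rewrite ler_wpM2l// powR_le_tangent.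
have E i : w i * (m `^ p * (p * (f i / m) + (1 - p))) =
    m `^ p * (p / m * (w i * f i) + (1 - p) * w i) by ring.
under eq_bigr do rewrite E.
rewrite -mulr_sumr big_split/= -!mulr_sumr w1 -/m divfK ?gt_eqF// mulr1.
by rewrite addrC subrK mulr1.
Qed.

(* Both sides agree at u = v. *)
Lemma powersum_le_weighted (R : realType) (d : nat) (xi : R) (u v : 'rV[R]_d) :
  0 < xi <= 1 -> (0 < d)%N ->
  (forall j, 0 <= u ord0 j) -> (forall j, 0 < v ord0 j) ->
  powersum xi u <= powersum xi v *
    \sum_(j < d) v ord0 j `^ xi / (\sum_(i < d) v ord0 i `^ xi) *
                 (u ord0 j / v ord0 j).
Proof.
move=> hxi d0 u0 v0; have /andP[xi0 _] := hxi.
set S := \sum_(i < d) v ord0 i `^ xi.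
have S0 : 0 < S.
  rewrite /S (bigD1 (Ordinal d0))//= ltr_pwDl ?powR_gt0// sumr_ge0// => j _.
  exact: powR_ge0.
have r0 j : 0 <= u ord0 j / v ord0 j by rewrite divr_ge0// ltW.
set L := \sum_(j < d) _.
have L0 : 0 <= L.
  by apply: sumr_ge0 => j _; rewrite mulr_ge0// divr_ge0 ?powR_ge0// ltW.
have powS : \sum_(j < d) u ord0 j `^ xi <= S * L `^ xi.
  (* Factor u_j = v_j (u_j / v_j); Jensen then applies to the ratios with weights v_j^xi / S. *)
  have -> : \sum_(j < d) u ord0 j `^ xi =
      S * \sum_(j < d) v ord0 j `^ xi / S * (u ord0 j / v ord0 j) `^ xi.
    rewrite mulr_sumr; apply: eq_bigr => j _.
    rewrite -[in LHS](divfK (lt0r_neq0 (v0 j)) (u ord0 j)) [LHS]powRM ?(ltW (v0 j))//.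
    by field; rewrite gt_eqF.
  rewrite ler_pM2l//; apply: powR_jensen => // [j|].
    by rewrite divr_ge0 ?powR_ge0// ltW.
  by rewrite -mulr_suml divff ?gt_eqF.
apply: (@le_trans _ _ ((S * L `^ xi) `^ xi^-1)).
  apply: ge0_ler_powR => //; rewrite ?invr_ge0 ?ltW// nnegrE.
    by apply: sumr_ge0 => j _; exact: powR_ge0.
  by rewrite mulr_ge0 ?powR_ge0// ltW.
by rewrite powRM ?powR_ge0 ?(ltW S0)// -powRrM divff ?gt_eqF// powRr1.
Qed.

(** * Spike points of the simplex *)

Definition spike (R : realType) (d : nat) (a : R) (k : 'I_d) : 'rV[R]_d :=
  \row_(j < d) if j == k then a else (1 - a) / (d%:R - 1).

Section spike.
Variables (R : realType) (d : nat).
Hypothesis hd : (2 <= d)%N.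
Implicit Types (a xi : R) (k : 'I_d).

Let d1 : (0 : R) < d%:R - 1. Proof. by rewrite subr_gt0 ltr1n. Qed.

(** A general [F] covers both the total mass and the power sum; the value is independent of [k]. *)
Lemma sum_spike a k (F : R -> R) :
  \sum_(j < d) F (spike a k ord0 j) =
  F a + (d%:R - 1) * F ((1 - a) / (d%:R - 1)).
Proof.
rewrite (bigD1 k)//= mxE eqxx; congr (_ + _).
rewrite (eq_bigr (fun=> F ((1 - a) / (d%:R - 1)))) => [|j /negPf jk]; last first.
  by rewrite mxE jk.
rewrite sumr_const cardC1 card_ord -[LHS]mulr_natl; congr (_ * _).
by rewrite -subn1 natrB// ltnW.
Qed.

Lemma spike_simplex a k : 0 <= a <= 1 -> simplex R d (spike a k).
Proof.
move=> /andP[a0 a1]; split=> [j|].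
  by rewrite mxE; case: ifP => // _; rewrite divr_ge0 ?(ltW d1)// subr_ge0.
by rewrite (sum_spike a k id) mulrC divfK ?gt_eqF// addrC subrK.
Qed.

(** The condition a >= 1/d is equivalent to (1 - a) / (d - 1) <= a. *)
Lemma maxcoord_spike a k : d%:R^-1 <= a -> maxcoord (spike a k) = a.
Proof.
move=> da.
have d0 : (0 : R) < d%:R by rewrite ltr0n ltnW.
have a0 : 0 <= a by rewrite (le_trans _ da)// invr_ge0 ltW.
apply/eqP; rewrite eq_le; apply/andP; split.
  apply: bigmax_le => // j _; rewrite mxE; case: ifP => // _.
  have : 1 <= a * d%:R by rewrite -ler_pdivrMr// div1r.
  by rewrite ler_pdivrMr//; lra.
by apply: (bigmax_sup k) => //; rewrite mxE eqxx.
Qed.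

Lemma Ubound_spike xi theta k : 0 < xi <= 1 -> 1 <= theta <= d%:R ->
  Ubound d xi theta = d%:R * powersum xi (spike (theta / d%:R) k).
Proof.
move=> /andP[xi0 xi1] /andP[t1 td].
have t0 : 0 <= theta by lra.
have d0 : (0 : R) < d%:R by rewrite ltr0n ltnW.
rewrite /powersum (sum_spike _ k (fun x => x `^ xi)) /Ubound.
have -> : (1 - theta / d%:R) / (d%:R - 1) = (d%:R - theta) * (d%:R^-1 * (d%:R - 1)^-1).
  by field; rewrite !gt_eqF.
(* This moves the factor d under the outer power 1/xi, where d^xi cancels the denominators d of the
   coordinates. *)
have Ed : (d%:R : R) = (d%:R `^ xi) `^ xi^-1.
  by rewrite -powRrM divff ?gt_eqF// powRr1// ltW.
rewrite [X in _ = X * _]Ed -[RHS]powRM ?powR_ge0//; last first.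
  by rewrite addr_ge0 ?powR_ge0// mulr_ge0 ?powR_ge0// ltW.
congr (_ `^ _).
have ds : d%:R - theta >= 0 by rewrite subr_ge0.
rewrite !powRM ?invr_ge0 ?(ltW d0) ?(ltW d1) ?mulr_ge0 ?invr_ge0 ?(ltW d0) ?(ltW d1)//.
rewrite powRB ?(gt_eqF d1) ?implybT// powRr1 ?(ltW d1)//.
have powRV x : 0 < x -> x^-1 `^ xi = (x `^ xi)^-1.
  by move=> x0; rewrite -[in LHS]powR_inv1 ?ltW// -powRrM mulN1r powRN.
rewrite !powRV//.
by field; rewrite !gt_eqF ?powR_gt0.
Qed.

End spike.

(** * Largest coordinate and the affine bound *)

Lemma maxcoord_attained (R : realType) (d : nat) (u : 'rV[R]_d) :
  simplex R d u -> exists k, maxcoord u = u ord0 k.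
Proof.
move=> [u0 u1].
case: d u u0 u1 => [|d] u u0 u1.
  by move: u1; rewrite big_ord0 => /esym/eqP; rewrite oner_eq0.
have [k _ kmax] := @Order.TotalTheory.arg_maxP _ _ _ ord0 xpredT (fun j => u ord0 j) isT.
exists k; apply/eqP; rewrite eq_le; apply/andP; split.
  (* The default 0 of the big maximum is dominated because coordinates are nonnegative. *)
  by apply: bigmax_le => // j _; exact: kmax.
exact: (bigmax_sup k).
Qed.

Lemma coord_le1 (R : realType) (d : nat) (u : 'rV[R]_d) j :
  simplex R d u -> u ord0 j <= 1.
Proof.
move=> [u0 <-]; rewrite (bigD1 j)//= lerDl.
exact: sumr_ge0.
Qed.

Lemma maxcoord_ge0 (R : realType) (d : nat) (u : 'rV[R]_d) : 0 <= maxcoord u.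
Proof. by rewrite /maxcoord; elim/big_rec: _ => // i x _ x0; rewrite le_max x0 orbT. Qed.

Lemma maxcoord_le1 (R : realType) (d : nat) (u : 'rV[R]_d) :
  simplex R d u -> maxcoord u <= 1.
Proof. by move=> su; apply: bigmax_le => // j _; exact: coord_le1. Qed.

(** Needed when theta = d: the spike is then a vertex, and its zero coordinates rule out linearizing
    there. *)
Lemma powersum_vertex (R : realType) (d : nat) (xi : R) (u : 'rV[R]_d) :
  0 < xi -> simplex R d u -> maxcoord u = 1 -> powersum xi u = 1.
Proof.
move=> xi0 su; have [k ->] := maxcoord_attained su => uk.
have [u0 u1] := su.
have uj j : j != k -> u ord0 j = 0.
  move: u1; rewrite (bigD1 k)//= uk -[RHS]addr0 => /addrI /psumr_eq0P.
  by move=> h jk; apply: h.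
rewrite /powersum (bigD1 k)//= big1 => [|j jk]; last first.
  by rewrite uj// powR0// gt_eqF.
by rewrite addr0 uk !powR1.
Qed.

(** Strictness of theta < d keeps all spike coordinates positive. The signs of [alpha] and [beta]
    allow the bound to be integrated term by term as nonnegative functions. *)
Lemma powersum_le_affine (R : realType) (d : nat) (xi theta : R) :
  (2 <= d)%N -> 0 < xi <= 1 -> 1 <= theta < d%:R ->
  exists alpha beta : R, [/\ 0 <= alpha, 0 <= beta,
    alpha * theta + beta * (d%:R - theta) = Ubound d xi theta &
    forall u, simplex R d u ->
      powersum xi u <= alpha * maxcoord u + beta * (1 - maxcoord u)].
Proof.
move=> hd hxi /andP[t1 td].
have t0 : 0 < theta by lra.
have d0 : (0 : R) < d%:R by rewrite ltr0n ltnW.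
have d1 : (0 : R) < d%:R - 1 by rewrite subr_gt0 ltr1n.
set a := theta / d%:R; set b := (1 - a) / (d%:R - 1).
have a0 : 0 < a by rewrite divr_gt0.
have b0 : 0 < b by rewrite divr_gt0// subr_gt0 ltr_pdivrMr// mul1r.
set S := a `^ xi + (d%:R - 1) * b `^ xi.
have S0 : 0 < S by rewrite addr_gt0 ?mulr_gt0 ?powR_gt0.
set P := S `^ xi^-1.
have P0 : 0 < P by rewrite powR_gt0.
(* These are the partial derivatives of [powersum xi] at [spike a k], along coordinate [k] and along
   any other one. *)
exists (P * (a `^ xi / S / a)), (P * (b `^ xi / S / b)); split.
- by rewrite ltW// mulr_gt0// divr_gt0// divr_gt0// powR_gt0.
- by rewrite ltW// mulr_gt0// divr_gt0// divr_gt0// powR_gt0.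
- rewrite (Ubound_spike hd (Ordinal (ltnW hd)))// ?t1 ?ltW//.
  rewrite /powersum (sum_spike hd _ _ (fun x => x `^ xi)) -/a -/b -/S -/P.
  (* Euler's identity for a function homogeneous of degree 1, multiplied by d. *)
  have -> : theta = d%:R * a by rewrite mulrC divfK ?gt_eqF.
  have -> : d%:R - d%:R * a = d%:R * (d%:R - 1) * b.
    by rewrite /b; field; rewrite gt_eqF.
  transitivity (d%:R * P * ((a `^ xi + (d%:R - 1) * b `^ xi) / S)).
    by field; rewrite !gt_eqF.
  by rewrite -/S divff ?gt_eqF// mulr1.
(* Place the spike at a largest coordinate of [u]; the other coordinates share one coefficient and
   sum to 1 - u_k. *)
- move=> u su; have [k ->] := maxcoord_attained su.
  have v0 j : 0 < spike a k ord0 j by rewrite mxE; case: ifP.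
  apply: (le_trans (powersum_le_weighted hxi (ltnW hd) su.1 v0)).
  rewrite /powersum (sum_spike hd _ _ (fun x => x `^ xi)) -/b -/S -/P.
  rewrite (bigD1 k)//= mxE eqxx.
  rewrite (eq_bigr (fun j => b `^ xi / S / b * u ord0 j)) => [|j /negPf jk]; last first.
    by rewrite mxE jk -/b mulrA mulrAC.
  rewrite -mulr_sumr.
  have -> : \sum_(j < d | j != k) u ord0 j = 1 - u ord0 k.
    by rewrite -su.2 [in RHS](bigD1 k)//= addrAC subrr add0r.
  rewrite le_eqVlt; apply/orP; left; apply/eqP; ring.
Qed.

(** * Borel measurability *)

Lemma measurable_coord (R : realType) (d : nat) (j : 'I_d) :
  measurable_fun [set: borel_rV R d] (fun u : borel_rV R d => u ord0 j).
Proof.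
apply: (measurability _ (RGenOpens.measurableE R)) => _ [_ [a [b ->] <-]].
rewrite setTI; apply: sub_sigma_algebra.
have /continuousP := @coord_continuous R 1 d ord0 j.
by apply; exact: interval_open.
Qed.

Lemma measurable_simplex (R : realType) (d : nat) :
  measurable (simplex R d : set (borel_rV R d)).
Proof.
have -> : (simplex R d : set (borel_rV R d)) =
    (\bigcap_(j in [set: 'I_d]) ((fun u : borel_rV R d => u ord0 j) @^-1` `[0, +oo[))
    `&` (fun u : borel_rV R d => \sum_(j < d) u ord0 j) @^-1` [set 1].
  apply/seteqP; split=> u /= [u0 u1]; split=> // j.
    by move=> _; rewrite /= in_itv/= u0.
  by have := u0 j I; rewrite /= in_itv/= andbT.
apply: measurableI.
  apply: fin_bigcap_measurable => // j _.
  by rewrite -[X in measurable X]setTI; apply: measurable_coord => //; exact: measurable_itv.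
rewrite -[X in measurable X]setTI.
by apply: measurable_sum => // j; exact: measurable_coord.
Qed.

Lemma measurable_powersum (R : realType) (d : nat) (xi : R) :
  measurable_fun [set: borel_rV R d] (fun u : borel_rV R d => powersum xi u).
Proof.
apply: (measurableT_comp (measurable_powR _)).
apply: measurable_sum => j; apply: (measurableT_comp (measurable_powR _)).
exact: measurable_coord.
Qed.

Lemma measurable_maxcoord (R : realType) (d : nat) :
  measurable_fun [set: borel_rV R d] (fun u : borel_rV R d => maxcoord u).
Proof.
rewrite /maxcoord; elim: (index_enum _) => [|j s IH].
  by under eq_fun do rewrite big_nil; exact: measurable_cst.
under eq_fun do rewrite big_cons.
by apply: measurable_maxr => //; exact: measurable_coord.
Qed.

(** * Upper bound for feasible measures *)

Section integrals.
Variables (R : realType) (d : nat).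
Variable H : {finite_measure set (borel_rV R d) -> \bar R}.
Local Notation D := (simplex R d : set (borel_rV R d)).

(** On the simplex 1 is the sum of the coordinates, so the d marginal constraints add up to the
    mass. *)
Lemma feasible_mass theta : feasible theta H ->
  (\int[H]_(u in D) 1 = d%:R%:E)%E.
Proof.
move=> [_ Hj _].
transitivity (\int[H]_(u in D) (\sum_(j < d) (u ord0 j)%:E))%E.
  by apply: eq_integral => u; rewrite inE => -[_ u1]; rewrite sumEFin u1.
rewrite ge0_integral_sum; first last.
- by move=> j u [u0 _]; rewrite lee_fin.
- move=> j; apply/measurable_EFinP; apply: measurable_funTS; exact: measurable_coord.
- exact: measurable_simplex.
by rewrite (eq_bigr (fun=> 1%E))// sumEFin sumr_const card_ord.
Qed.

Let measurable_comaxcoord :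
  measurable_fun D (fun u : borel_rV R d => (1 - maxcoord u)%:E).
Proof.
apply/measurable_EFinP; apply: measurable_funTS.
by apply: measurable_funB => //; exact: measurable_maxcoord.
Qed.

Lemma feasible_comaxcoord theta : feasible theta H ->
  (\int[H]_(u in D) (1 - maxcoord u)%:E = (d%:R - theta)%:E)%E.
Proof.
move=> fH; have [_ _ Hmax] := fH.
have : (\int[H]_(u in D) ((maxcoord u)%:E + (1 - maxcoord u)%:E) = d%:R%:E)%E.
  rewrite -(feasible_mass fH); apply: eq_integral => u _.
  by rewrite -EFinD addrC subrK.
rewrite ge0_integralD//; first last.
- by move=> u su; rewrite lee_fin subr_ge0 maxcoord_le1.
- apply/measurable_EFinP; apply: measurable_funTS; exact: measurable_maxcoord.
- by move=> u _; rewrite lee_fin maxcoord_ge0.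
- exact: measurable_simplex.
(* An infinite integral would contradict the finite sum, so theta can be subtracted. *)
rewrite Hmax; case: (integral _ _ _) => [r||]//=.
by rewrite -EFinD => -[<-]; rewrite addrC addKr.
Qed.

Lemma integral_powersum_le xi theta :
  (2 <= d)%N -> 0 < xi <= 1 -> 1 <= theta <= d%:R -> feasible theta H ->
  (\int[H]_(u in D) (powersum xi u)%:E <= (Ubound d xi theta)%:E)%E.
Proof.
move=> hd hxi /andP[t1]; rewrite le_eqVlt => /orP[/eqP td|td] fH.
  (* The affine bound has infinite slope here, but H lives on the vertices. *)
  have xi0 : 0 < xi by case/andP: hxi.
  have -> : Ubound d xi theta = d%:R.
    rewrite /Ubound td subrr powR0 ?gt_eqF// mulr0 addr0 -powRrM divff ?gt_eqF//.
    by rewrite powRr1.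
  (* A nonnegative function with integral d - theta = 0 vanishes almost everywhere; [powersum] is
     then 1 almost everywhere and integrates to the mass d. *)
  have max1 : ae_eq H D (fun u => (1 - maxcoord u)%:E) (cst 0%E).
    apply/ae_eq_integral_abs => //; first exact: measurable_simplex.
    transitivity (\int[H]_(u in D) (1 - maxcoord u)%:E)%E.
      apply: eq_integral => u; rewrite inE => su.
      by rewrite gee0_abs// lee_fin subr_ge0 maxcoord_le1.
    by rewrite (feasible_comaxcoord fH) td subrr.
  rewrite -(feasible_mass fH) le_eqVlt; apply/orP; left; apply/eqP.
  apply: ae_eq_integral => //.
  - exact: measurable_simplex.
  - by apply/measurable_EFinP; apply: measurable_funTS; exact: measurable_powersum.
  - apply: filterS max1 => u /= + su => /(_ su) [/eqP].
    by rewrite subr_eq0 eq_sym => /eqP /(powersum_vertex xi0 su) ->.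
have [al [be [al0 be0 <- le]]] := powersum_le_affine hd hxi (introT andP (conj t1 td)).
have mD := @measurable_simplex R d.
have mmax : measurable_fun D (fun u : borel_rV R d => (maxcoord u)%:E).
  by apply/measurable_EFinP; apply: measurable_funTS; exact: measurable_maxcoord.
have max0 u : D u -> (0 <= (maxcoord u)%:E)%E by rewrite lee_fin maxcoord_ge0.
have comax0 u : D u -> (0 <= (1 - maxcoord u)%:E)%E.
  by move=> su; rewrite lee_fin subr_ge0 maxcoord_le1.
apply: (@le_trans _ _ (\int[H]_(u in D)
    (al%:E * (maxcoord u)%:E + be%:E * (1 - maxcoord u)%:E))%E).
  apply: ge0_le_integral => //.
  - by move=> u _; rewrite lee_fin powR_ge0.
  - by apply/measurable_EFinP; apply: measurable_funTS; exact: measurable_powersum.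
  - by apply: emeasurable_funD; exact: measurable_funeM.
rewrite ge0_integralD//; first last.
- exact: measurable_funeM.
- by move=> u su; rewrite mule_ge0 ?comax0.
- exact: measurable_funeM.
- by move=> u su; rewrite mule_ge0 ?max0.
rewrite !ge0_integralZl_EFin// (feasible_comaxcoord fH).
by have [_ _ ->] := fH; rewrite -!EFinM -EFinD.
Qed.

End integrals.

(** * The extremal measure *)

Section spike_measure.
Variables (R : realType) (n : nat) (a : R).
Local Notation D := (simplex R n.+1 : set (borel_rV R n.+1)).

(* [msum] is indexed by [nat], hence the [inord]. *)
Definition spike_measure : set (borel_rV R n.+1) -> \bar R :=
  msum (fun i => \d_(spike a (inord i : 'I_n.+1) : borel_rV R n.+1)) n.+1.

HB.instance Definition _ := Measure.on spike_measure.

Let spike_measure_fin : fin_num_fun spike_measure.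
Proof.
move=> U mU; rewrite /spike_measure /msum/=.
by apply/sum_fin_numP => i _ _; rewrite diracE.
Qed.

HB.instance Definition _ :=
  @Measure_isFinite.Build _ _ _ spike_measure spike_measure_fin.

Hypotheses (n0 : (0 < n)%N) (a01 : 0 <= a <= 1).

(** All atoms lie in the simplex, so restricting the integral to [D] loses none of them. *)
Lemma integral_spike_measure (f : borel_rV R n.+1 -> R) :
  measurable_fun setT f -> (forall u, D u -> 0 <= f u) ->
  (\int[spike_measure]_(u in D) (f u)%:E =
   (\sum_(k < n.+1) f (spike a k))%:E)%E.
Proof.
move=> mf f0.
have mD := @measurable_simplex R n.+1.
have mfD : measurable_fun D (fun u => (f u)%:E).
  by apply/measurable_EFinP; exact: measurable_funTS.
rewrite ge0_integral_measure_sum//=.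
rewrite -sumEFin; apply: eq_bigr => k _.
by rewrite integral_dirac//= inord_val diracE mem_set ?mul1e//; exact: spike_simplex.
Qed.

End spike_measure.
Arguments spike_measure {R} n a.

Lemma ratio_itv (R : realFieldType) (d : nat) (theta : R) :
  (0 < d)%N -> 1 <= theta <= d%:R ->
  d%:R^-1 <= theta / d%:R /\ 0 <= theta / d%:R <= 1.
Proof.
rewrite -(ltr0n R) => d0 /andP[t1 td]; split.
  by rewrite ler_peMl// invr_ge0 ltW.
rewrite divr_ge0 ?(ltW d0) ?(le_trans _ t1)//=.
by rewrite ler_pdivrMr// mul1r.
Qed.

Lemma spike_measure_feasible (R : realType) (n : nat) (theta : R) :
  (0 < n)%N -> 1 <= theta <= n.+1%:R ->
  feasible theta (spike_measure n (theta / n.+1%:R)).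
Proof.
move=> n0 /andP[t1 tn].
have d0 : (0 : R) < n.+1%:R by rewrite ltr0n.
set a := theta / n.+1%:R.
have [da a01] : n.+1%:R^-1 <= a /\ 0 <= a <= 1.
  by apply: ratio_itv; rewrite ?t1.
split.
- rewrite /= /spike_measure /msum big1// => k _; rewrite /= diracE memNset//; apply.
  exact: spike_simplex.
- move=> j; rewrite integral_spike_measure//; first last.
  + by move=> u [].
  + exact: measurable_coord.
  (* Coordinate [j] of [spike a k] is symmetric in [j] and [k], so summing over atoms amounts to
     summing the coordinates of [spike a j]. *)
  congr (_%:E); rewrite -[RHS](@spike_simplex R n.+1 n0 a j a01).2.
  by apply: eq_bigr => k _; rewrite !mxE eq_sym.
- rewrite integral_spike_measure//; first last.
  + by move=> u _; exact: maxcoord_ge0.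
  + exact: measurable_maxcoord.
  congr (_%:E); rewrite (eq_bigr (fun=> a)) => [|k _]; last exact: maxcoord_spike.
  by rewrite sumr_const card_ord -[LHS]mulr_natr divfK ?gt_eqF.
Qed.

Theorem theorem3p8 (R : realType) (d : nat) (xi theta : R)
    (hd : (2 <= d)%N) (hxi : 0 < xi <= 1) (htheta : 1 <= theta <= d%:R) :
  valU d xi theta = (Ubound d xi theta)%:E /\
  (Ubound d xi theta)%:E =
    ereal_sup [set (d%:R * powersum xi u)%:E |
      u in [set u : 'rV[R]_d | simplex R d u /\ maxcoord u = theta / d%:R]].
Proof.
case: d hd htheta => // n n0 htheta; have /andP[t1 tn] := htheta.
have d0 : (0 : R) < n.+1%:R by rewrite ltr0n.
have [da a01] := ratio_itv (ltn0Sn n) htheta.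
have feasH := spike_measure_feasible n0 htheta.
split; apply/eqP; rewrite eq_le; apply/andP; split.
- by apply: ge_ereal_sup => _ [H fH <-]; exact: integral_powersum_le.
- apply: ereal_sup_ubound; exists (spike_measure n (theta / n.+1%:R)) => //.
  rewrite integral_spike_measure//; first last.
  + by move=> u _; exact: powR_ge0.
  + exact: measurable_powersum.
  rewrite (eq_bigr (fun=> powersum xi (spike (theta / n.+1%:R) (ord0 : 'I_n.+1)))).
    by rewrite sumr_const card_ord -[_ *+ n.+1]mulr_natl -Ubound_spike.
  by move=> k _; rewrite /powersum !(sum_spike n0 _ _ (fun x => x `^ xi)).
- apply: ereal_sup_ubound; exists (spike (theta / n.+1%:R) ord0).
    by split; [exact: spike_simplex | exact: maxcoord_spike].
  by rewrite -Ubound_spike.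
(* With the maximum fixed at theta/d, d times the affine bound is exactly [Ubound]. If theta = d,
   both [u] and the spike are vertices, with power sum 1. *)
- apply: ge_ereal_sup => _ [u [su mu] <-]; rewrite lee_fin.
  move: (tn); rewrite le_eqVlt => /orP[/eqP td|td].
    rewrite (powersum_vertex _ su); first last.
    + by rewrite mu td divff// gt_eqF.
    + by case/andP: hxi.
    rewrite (Ubound_spike n0 ord0)// (powersum_vertex (u := spike _ _))//.
    + by case/andP: hxi.
    + exact: spike_simplex.
    + by rewrite maxcoord_spike// td divff// gt_eqF.
  have [al [be [al0 be0 <- le]]] := powersum_le_affine n0 hxi (introT andP (conj t1 td)).
  apply: (@le_trans _ _ (n.+1%:R * (al * maxcoord u + be * (1 - maxcoord u)))).
    by rewrite ler_wpM2l ?le// ltW.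
  rewrite mu le_eqVlt; apply/orP; left; apply/eqP.
  by field; rewrite gt_eqF.
Qed.
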